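(* Let $\mathcal{H}=\Delta_{b,m}+V$ be a positive Schrödinger operator associated to a connected graph $b$ over $(X,m)$ with potential $V\le 1$. Let $\mathcal{H}'$ be a critical Schrödinger operator, associated to a connected graph $b'$ over $(X,m)$ (and some potential), with Agmon ground state $v>0$. If $u$ is an $\mathcal{H}$-harmonic function satisfying $$ b(x,y)\,|u(x)|\,|u(y)|\le C\, b'(x,y)\,v(x)\,v(y)\quad\text{for all }x,y\in X, \text{ for some constant } C>0,$$ and $$\liminf_{x\to\infty}\frac{|u(x)|}{G_1(x)}=0,$$ then $u=0$.
   Context: Setting. $X$ is an infinite countable set with the discrete topology (compact subsets are the finite subsets), and $m:X\to(0,\infty)$ is a strictly positive function, regarded as a measure of full support. A graph $b$ over $(X,m)$ is a symmetric function $b:X\times X\to[0,\infty)$ with zero diagonal and $\sum_{y\in X}b(x,y)<\infty$ for all $x\in X$. Write $x\sim y$ if $b(x,y)>0$; $b$ is connected if any two vertices are joined by a finite path $x=x_0\sim\dots\sim x_n=y$. Let $\mathcal{F}_b=\{f:X\to\mathbb{R}\mid \sum_{y}b(x,y)|f(y)|<\infty \text{ for all }x\in X\}$. The Laplacian is $\Delta f(x)=\Delta_{b,m}f(x)=\frac1{m(x)}\sum_{y\in X}b(x,y)(f(x)-f(y))$ for $f\in\mathcal{F}_b$. A potential is a function $V:X\to\mathbb{R}$, and the Schrödinger operator associated to $b$ and $V$ is $\mathcal{H}f=\Delta f+Vf$, $f\in\mathcal{F}_b$. A function $u$ is $\mathcal{H}$-harmonic (resp. superharmonic) if $u\in\mathcal{F}_b$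 and $\mathcal{H}u=0$ (resp. $\ge0$) on $X$. A function $f$ is called positive if $f\ge0$ and $f\neq0$, strictly positive (written $f>0$) if $f(x)>0$ for all $x$. $\mathcal{H}$ is positive if there is a positive $\mathcal{H}$-superharmonic function on $X$; equivalently, the energy form $\mathcal{Q}(\varphi)=\frac12\sum_{x,y}b(x,y)(\varphi(x)-\varphi(y))^2+\sum_x m(x)V(x)\varphi(x)^2$ is nonnegative for all finitely supported $\varphi$. A positive $\mathcal{H}$ is subcritical if there is a nontrivial $W\ge0$ with $\mathcal{Q}(\varphi)\ge\sum_x m(x)W(x)\varphi(x)^2$ for all finitely supported $\varphi$; a positive $\mathcal{H}$ is critical if it is not subcritical. A positive function $\phi\in\mathcal{F}_b$ is a positive solution of minimal growth at infinity for $\mathcal{H}$ if there is a finite $K_0\subset X$ with $\phi>0$ and $\mathcal{H}\phi=0$ in $X\setminus K_0$, and for every finite $K\supseteq K_0$ and every positive $\psi\in\mathcal{F}_b$ with $\psi>0$ and $\mathcal{H}\psi\ge0$ on $X\setminus K$ and $\phi\le\psi$ on $K$, one has $\phi\le\psi$ on $X\setminus K$. An Agmon ground state of $\mathcal{H}$ is a positive $\mathcal{H}$-harmonic function on $X$ that is a positive solution of minimal growth at infinity. Fix a vertex $o\in X$. $G_1$ is the Green function of $\Delta+1$ (with $\Delta=\Delta_{b,m}$) at $o$: the smallest strictly positive function $\phi$ with $(\Delta+1)\phi\ge 1_o$, where $1_o$ is the characteristic function of $\{o\}$; it satisfies $(\Delta+1)G_1=1_o$. The limit $x\to\infty$ is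 taken in the one-point compactification $X\cup\{\infty\}$ (i.e. $x$ leaves every finite set). *)

(* Defs.v *)
From mathcomp Require Import all_boot all_order all_algebra.
From mathcomp Require Import boolp classical_sets functions cardinality fsbigop.
From mathcomp Require Import filter reals ereal topology normedtype numfun esum.

Set Implicit Arguments.
Unset Strict Implicit.
Unset Printing Implicit Defensive.

Import Order.TTheory GRing.Theory Num.Theory.

Local Open Scope classical_set_scope.
Local Open Scope ring_scope.

Section SchroedingerOperators.
Context {R : realType} {X : discreteTopologicalType}.
Implicit Types (b : X -> X -> R) (m V f u : X -> R).

Record is_graph b : Prop := IsGraph {
  graph_ge0 : forall x y, 0 <= b x y;
  graph_sym : forall x y, b x y = b y x;
  graph_diag : forall x, b x x = 0;
  graph_summable : forall x, (\esum_(y in [set: X]) (b x y)%:E < +oo)%E }.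

Definition connected_graph b : Prop :=
  forall x y, exists s : seq X, path [rel z w | 0 < b z w] x s /\ last x s = y.

Definition positive_fun f : Prop := (forall x, 0 <= f x) /\ f <> cst 0.

Definition strictly_positive f : Prop := forall x, 0 < f x.

Definition finitely_supported f : Prop := finite_set [set x | f x != 0].

Definition formal_domain b : set (X -> R) :=
  [set f | forall x, (\esum_(y in [set: X]) (b x y * `|f y|)%:E < +oo)%E].

(* The unordered sum of an absolutely summable real family. It is a junk value
   on other families; below it is only meaningful for summable ones. *)
Definition abs_sum (a : X -> R) : R :=
  fine (\esum_(y in [set: X]) (EFin \o a)^\+%E y)
  - fine (\esum_(y in [set: X]) (EFin \o a)^\-%E y).

(* For a graph b and f in formal_domain b the family below is absolutely
   summable. *)
Definition laplacian b m f (x : X) : R :=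
  (m x)^-1 * abs_sum (fun y => b x y * (f x - f y)).

Definition schroedinger b m V f (x : X) : R := laplacian b m f x + V x * f x.

Definition harmonic b m V u : Prop :=
  formal_domain b u /\ forall x, schroedinger b m V u x = 0.

Definition superharmonic b m V u : Prop :=
  formal_domain b u /\ forall x, 0 <= schroedinger b m V u x.

Definition positive_operator b m V : Prop :=
  exists u, positive_fun u /\ superharmonic b m V u.

(* Both sums over x below have finite support when phi is finitely supported
   (\sum_(_ \in _) is a junk 0 otherwise), and the sum over pairs is finite by
   summability of the rows of b. *)
Definition energy_form b m V (phi : X -> R) : R :=
  2^-1 * fine (\esum_(p in [set: X * X])
                 (b p.1 p.2 * (phi p.1 - phi p.2) ^+ 2)%:E)
  + \sum_(x \in [set: X]) m x * V x * phi x ^+ 2.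

Definition subcritical b m V : Prop :=
  exists W, positive_fun W /\
    forall phi, finitely_supported phi ->
      \sum_(x \in [set: X]) m x * W x * phi x ^+ 2 <= energy_form b m V phi.

Definition critical b m V : Prop :=
  positive_operator b m V /\ ~ subcritical b m V.

Definition minimal_growth b m V (phi : X -> R) : Prop :=
  [/\ positive_fun phi, formal_domain b phi &
    exists K0 : set X,
      [/\ finite_set K0,
          forall x, ~ K0 x -> 0 < phi x /\ schroedinger b m V phi x = 0 &
          forall (K : set X) (psi : X -> R),
            finite_set K -> K0 `<=` K ->
            positive_fun psi -> formal_domain b psi ->
            (forall x, ~ K x -> 0 < psi x /\ 0 <= schroedinger b m V psi x) ->
            (forall x, K x -> phi x <= psi x) ->
            forall x, ~ K x -> phi x <= psi x]].

Definition agmon_ground_state b m V v : Prop :=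
  [/\ positive_fun v, harmonic b m V v & minimal_growth b m V v].

Definition green_supersolution b m V (o : X) (phi : X -> R) : Prop :=
  [/\ strictly_positive phi, formal_domain b phi &
      forall x, \1_[set o] x <= schroedinger b m V phi x].

(* The Green function at o is unique when it exists; it is therefore described
   by a predicate: the smallest element of green_supersolution. *)
Definition is_green_function b m V (o : X) (G : X -> R) : Prop :=
  green_supersolution b m V o G /\
  forall phi, green_supersolution b m V o phi -> forall x, G x <= phi x.

(* frechet_filter X, the cofinite filter, is the trace on the discrete space X
   of the neighbourhood filter of infinity in the one-point compactification. *)
Definition liminf_at_infinity f : \bar R :=
  limf_einf (fun x => (f x)%:E) (@frechet_filter X).

End SchroedingerOperators.

(* Main.v *)
Require Import Defs.
From mathcomp Require Import all_boot all_order all_algebra.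
From mathcomp Require Import boolp classical_sets functions cardinality fsbigop.
From mathcomp Require Import filter reals ereal topology normedtype numfun esum.
From mathcomp Require Import ring lra.

Set Implicit Arguments.
Unset Strict Implicit.
Unset Printing Implicit Defensive.

Import Order.TTheory GRing.Theory Num.Theory.

Local Open Scope classical_set_scope.
Local Open Scope ring_scope.

(** Why the theorem holds.

    Liouville comparison.  Let w = |u| and let h be a positive superharmonic
    function of H; it is strictly positive because b is connected
    ([superharmonic_gt0]).  The ground state transform writes the energy of a
    product, for w >= 0 and f of finite support, as
<<
      Q(w f) = 1/2 sum_{x,y} b(x,y) w(x) w(y) (f(x) - f(y))^2
               + sum_x m(x) f(x)^2 w(x) (H w)(x)
>>
    ([ground_state_transform]).  It bounds Q(h g) from below by the edge energy
    of g with weights b h h, and, since w H w <= 0 ([abs_subharmonic]), it bounds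
    Q(w f) from above by the edge energy of f with weights b w w.  With
    g = w f / h both products are the same function, so

      energy of (w/h) f for b h h  <=  energy of f for b w w
                                   <=  C * energy of f for b' v v,

    where the last step is the assumed bound on b |u| |u|.  Criticality of H'
    says that the last energy can be made arbitrarily small compared
    with f(x)^2 at any prescribed vertex x: otherwise a multiple of the
    indicator of x would be a Hardy weight for H' ([critical_recurrent]).
    For an edge x ~ y of b with w(x) > 0, smallness of the second energy
    forces f(y) w(y) to be close to f(x) w(y), and smallness of the first forces
    (w/h)(x) f(x) to be close to (w/h)(y) f(y); hence w/h has the same value at
    x and y ([ratio_eq_on_edges]).  By connectedness |u| = d h for a constant d.

    Comparison with the Green function.  As V <= 1, the function h is also
    superharmonic for Delta + 1.  If c = h(o) / G_1(o), then min(G_1, h / c) is a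
    supersolution for G_1: at o it equals G_1(o) and lies below G_1 elsewhere,
    and away from o the minimum of two supersolutions is a supersolution.  By
    minimality of G_1, c G_1 <= h ([green_le_superharmonic]).

    If u were not 0, then d > 0 and |u| / G_1 >= d c > 0 everywhere, against the
    vanishing of the lower limit. *)

(** * Absolutely convergent unordered sums *)

Section UnorderedSums.
Context {R : realType}.
Implicit Type T : choiceType.

Definition absolutely_summable T (a : T -> R) : Prop :=
  summable [set: T] (EFin \o a).

(** On a space of vertices this is [abs_sum]; here the index type is arbitrary, so
    that sums over pairs of vertices are covered too. *)
Definition usum T (a : T -> R) : R :=
  fine (\esum_(x in [set: T]) (EFin \o a)^\+%E x)
  - fine (\esum_(x in [set: T]) (EFin \o a)^\-%E x).

Lemma eq_usum T (a b : T -> R) : a =1 b -> usum a = usum b.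
Proof. by move=> /funext->. Qed.

Lemma summable_le T (a b : T -> R) :
  (forall x, `|a x| <= `|b x|) ->
  absolutely_summable b -> absolutely_summable a.
Proof.
by move=> ab; apply: le_lt_trans; apply: le_esum => x _; rewrite /= lee_fin.
Qed.

Lemma eq_summable T (a b : T -> R) :
  a =1 b -> absolutely_summable a -> absolutely_summable b.
Proof. by move=> /funext->. Qed.

Lemma ge0_summableE T (a : T -> R) : (forall x, 0 <= a x) ->
  absolutely_summable a = (\esum_(x in [set: T]) (a x)%:E < +oo)%E :> Prop.
Proof.
move=> a0; rewrite /absolutely_summable /summable; congr (is_true (_ < _)%E).
by apply: eq_esum => x _ /=; rewrite ger0_norm.
Qed.

Lemma ge0_usumE T (a : T -> R) : (forall x, 0 <= a x) ->
  usum a = fine (\esum_(x in [set: T]) (a x)%:E).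
Proof.
move=> a0; rewrite /usum.
rewrite [X in _ - fine X]esum1 ?subr0; last first.
  by move=> x _; rewrite funenegE /= max_r// lee_fin oppr_le0.
by congr fine; apply: eq_esum => x _; rewrite funeposE /= max_l// lee_fin.
Qed.

Lemma esum_EFin T (a : T -> R) : (forall x, 0 <= a x) ->
  absolutely_summable a ->
  \esum_(x in [set: T]) (a x)%:E = (usum a)%:E.
Proof.
move=> a0 sa; rewrite ge0_usumE// fineK// ge0_fin_numE.
  by rewrite -ge0_summableE.
by apply: esum_ge0 => x _; rewrite lee_fin.
Qed.

Lemma absolutely_summableD T (a b : T -> R) : absolutely_summable a ->
  absolutely_summable b -> absolutely_summable (fun x => a x + b x).
Proof. by move=> sa sb; exact: summableD sa sb. Qed.

Lemma absolutely_summableN T (a : T -> R) : absolutely_summable a ->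
  absolutely_summable (fun x => - a x).
Proof. by apply: summable_le => x; rewrite normrN. Qed.

Lemma absolutely_summableB T (a b : T -> R) : absolutely_summable a ->
  absolutely_summable b -> absolutely_summable (fun x => a x - b x).
Proof.
by move=> sa sb; apply: absolutely_summableD => //;
  exact: absolutely_summableN.
Qed.

Lemma ge0_esumZ T (c : R) (a : T -> R) : 0 <= c -> (forall x, 0 <= a x) ->
  \esum_(x in [set: T]) (c * a x)%:E =
    (c%:E * \esum_(x in [set: T]) (a x)%:E)%E.
Proof.
move=> c0 a0; rewrite /esum -ereal_supZl//; last first.
  apply/set0P; exists 0%E; exists set0; first exact: fsets_set0.
  by rewrite fsbig_set0.
congr ereal_sup; rewrite image_comp; apply: eq_imagel => A _ /=.
by rewrite ge0_mule_fsumr.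
Qed.

Lemma absolutely_summableZ T (c : R) (a : T -> R) : absolutely_summable a ->
  absolutely_summable (fun x => c * a x).
Proof.
move=> sa; suff: absolutely_summable (fun x => `|c| * `|a x|).
  by apply: summable_le => x; rewrite !normrM !normr_id.
rewrite ge0_summableE; last by move=> x; rewrite mulr_ge0.
rewrite ge0_esumZ// esum_EFin -?EFinM ?ltry//.
by apply: summable_le sa => x; rewrite normr_id.
Qed.

Lemma ge0_usumD T (a b : T -> R) :
  (forall x, 0 <= a x) -> (forall x, 0 <= b x) ->
  absolutely_summable a -> absolutely_summable b ->
  usum (fun x => a x + b x) = usum a + usum b.
Proof.
move=> a0 b0 sa sb; apply: EFin_inj; rewrite -esum_EFin; last 2 first.
- by move=> x; rewrite addr_ge0.
- exact: absolutely_summableD.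
by rewrite [RHS]EFinD -(esum_EFin a0 sa) -(esum_EFin b0 sb) -esumD//
  => x _; rewrite lee_fin.
Qed.

(** Reduces signed sums to sums of nonnegative terms. Allowing splittings other
    than positive and negative part is what makes additivity immediate. *)
Lemma usum_split T (a p q : T -> R) :
  (forall x, a x = p x - q x) ->
  (forall x, 0 <= p x) -> (forall x, 0 <= q x) ->
  absolutely_summable p -> absolutely_summable q ->
  usum a = usum p - usum q.
Proof.
move=> apq p0 q0 sp sq; have sa : absolutely_summable a.
  by rewrite (funext apq); exact: absolutely_summableB.
have fpos : esum setT (EFin \o a)^\+%E \is a fin_num.
  rewrite ge0_fin_numE; last by apply: esum_ge0.
  apply: le_lt_trans (summable_funepos sa).
  by apply: le_esum => x _; exact: lee_abs.
have fneg : esum setT (EFin \o a)^\-%E \is a fin_num.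
  rewrite ge0_fin_numE; last by apply: esum_ge0.
  apply: le_lt_trans (summable_funeneg sa).
  by apply: le_esum => x _; exact: lee_abs.
apply: EFin_inj; rewrite [RHS]EFinB -(esum_EFin p0 sp) -(esum_EFin q0 sq).
rewrite -esumB//; try by move=> x _; rewrite lee_fin.
have -> : (fun x => (p x)%:E - (q x)%:E)%E = EFin \o a.
  by apply/funext => x /=; rewrite apq.
by rewrite /usum [LHS]EFinB !fineK.
Qed.

Lemma funrpos_sub_neg T (a : T -> R) x : a x = a^\+ x - a^\- x.
Proof. by rewrite -[in LHS](funrposBneg a). Qed.

Lemma summable_funrpos T (a : T -> R) :
  absolutely_summable a -> absolutely_summable a^\+.
Proof.
apply: summable_le => x; rewrite (ger0_norm (funrpos_ge0 _ _)).
have /(congr1 (@^~ x)) /= <- := funrposDneg a.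
by rewrite lerDl funrneg_ge0.
Qed.

Lemma summable_funrneg T (a : T -> R) :
  absolutely_summable a -> absolutely_summable a^\-.
Proof. by move=> /absolutely_summableN/summable_funrpos; rewrite -funrposN. Qed.

Lemma usum_funrposneg T (a : T -> R) : absolutely_summable a ->
  usum a = usum a^\+ - usum a^\-.
Proof.
move=> sa; apply: usum_split; first exact: funrpos_sub_neg.
- exact: funrpos_ge0.
- exact: funrneg_ge0.
- exact: summable_funrpos.
- exact: summable_funrneg.
Qed.

Lemma usumD T (a b : T -> R) :
  absolutely_summable a -> absolutely_summable b ->
  usum (fun x => a x + b x) = usum a + usum b.
Proof.
move=> sa sb.
have [sap san] := (summable_funrpos sa, summable_funrneg sa).
have [sbp sbn] := (summable_funrpos sb, summable_funrneg sb).
have [ap an] := (funrpos_ge0 a, funrneg_ge0 a).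
have [bp bn] := (funrpos_ge0 b, funrneg_ge0 b).
rewrite (@usum_split _ _ (fun x => a^\+ x + b^\+ x)
                         (fun x => a^\- x + b^\- x)).
- rewrite !ge0_usumD// [usum a]usum_funrposneg// [usum b]usum_funrposneg//; lra.
- by move=> x; rewrite {1}(funrpos_sub_neg a) {1}(funrpos_sub_neg b); lra.
- by move=> x; rewrite addr_ge0.
- by move=> x; rewrite addr_ge0.
- exact: absolutely_summableD.
- exact: absolutely_summableD.
Qed.

Lemma usum_ge0 T (a : T -> R) : (forall x, 0 <= a x) -> 0 <= usum a.
Proof.
by move=> a0; rewrite ge0_usumE// fine_ge0// esum_ge0// => x _; rewrite lee_fin.
Qed.

Lemma usum0 T : usum (fun _ : T => 0) = 0.
Proof. by rewrite ge0_usumE// esum1. Qed.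

Lemma usumN T (a : T -> R) : absolutely_summable a ->
  usum (fun x => - a x) = - usum a.
Proof.
move=> sa; apply/eqP; rewrite -addr_eq0 -usumD//;
  last exact: absolutely_summableN.
by apply/eqP; rewrite -[RHS](usum0 T); apply: eq_usum => x; rewrite addNr.
Qed.

Lemma usumB T (a b : T -> R) :
  absolutely_summable a -> absolutely_summable b ->
  usum (fun x => a x - b x) = usum a - usum b.
Proof.
by move=> sa sb; rewrite usumD//; [rewrite usumN|exact: absolutely_summableN].
Qed.

Lemma le_usum T (a b : T -> R) :
  absolutely_summable a -> absolutely_summable b ->
  (forall x, a x <= b x) -> usum a <= usum b.
Proof.
move=> sa sb ab; rewrite -subr_ge0 -usumB//.
by apply: usum_ge0 => x; rewrite subr_ge0.
Qed.

Lemma usumZ T (c : R) (a : T -> R) : absolutely_summable a ->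
  usum (fun x => c * a x) = c * usum a.
Proof.
have ge0Z (d : R) (p : T -> R) : 0 <= d -> (forall x, 0 <= p x) ->
    absolutely_summable p -> usum (fun x => d * p x) = d * usum p.
  move=> d0 p0 sp; apply: EFin_inj; rewrite EFinM -!esum_EFin//; last 2 first.
  - by move=> x; rewrite mulr_ge0.
  - exact: absolutely_summableZ.
  by rewrite ge0_esumZ.
have ge0cZ (d : R) (p : T -> R) : 0 <= d -> absolutely_summable p ->
    usum (fun x => d * p x) = d * usum p.
  move=> d0 sp; have [sp1 sp2] := (summable_funrpos sp, summable_funrneg sp).
  rewrite [usum p]usum_funrposneg// mulrBr.
  rewrite -(ge0Z _ _ d0 (funrpos_ge0 p) sp1) -(ge0Z _ _ d0 (funrneg_ge0 p) sp2).
  apply: usum_split => [x|x|x||].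
  - by rewrite (funrpos_sub_neg p x) mulrBr.
  - by rewrite mulr_ge0// funrpos_ge0.
  - by rewrite mulr_ge0// funrneg_ge0.
  - exact: absolutely_summableZ.
  - exact: absolutely_summableZ.
move=> sa; have [c0|/ltW c0] := leP 0 c; first exact: ge0cZ.
rewrite -[c in LHS]opprK (eq_usum (b := fun x => - (- c * a x))); last first.
  by move=> x; rewrite mulNr.
rewrite usumN; last exact: absolutely_summableZ.
by rewrite ge0cZ ?oppr_ge0// mulNr opprK.
Qed.

Lemma le_usum_term T (a : T -> R) x : (forall y, 0 <= a y) ->
  absolutely_summable a -> a x <= usum a.
Proof.
move=> a0 sa; rewrite -lee_fin -esum_EFin//; apply: esum_ge.
by exists [set x]; [split|rewrite fsbig_set1].
Qed.

Lemma esum_swap T (a : T * T -> \bar R) :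
  \esum_(p in [set: T * T]) a (p.2, p.1) = \esum_(p in [set: T * T]) a p.
Proof.
rewrite [RHS](reindex_esum setT setT (fun p : T * T => (p.2, p.1)))//.
split=> //; first by move=> [? ?] [? ?] _ _ [-> ->].
by move=> [x y] _; exists (y, x).
Qed.

Lemma summable_swap T (a : T * T -> R) : absolutely_summable a ->
  absolutely_summable (fun p => a (p.2, p.1)).
Proof. by rewrite /absolutely_summable /summable -esum_swap. Qed.

Lemma usum_swap T (a : T * T -> R) : usum (fun p => a (p.2, p.1)) = usum a.
Proof.
rewrite /usum -[in RHS]esum_swap -[X in _ = _ - fine X]esum_swap.
congr (fine _ - fine _); apply: eq_esum => -[x y] _.
- by rewrite !funeposE.
- by rewrite !funenegE.
Qed.

Lemma ge0_esum_rows T (a : T -> T -> R) (F : set T) : finite_set F ->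
  (forall x y, 0 <= a x y) -> (forall x y, ~ F x -> a x y = 0) ->
  (forall x, absolutely_summable (a x)) ->
  \esum_(p in [set: T * T]) (a p.1 p.2)%:E = (\sum_(x \in F) usum (a x))%:E.
Proof.
move=> finF a0 aF sa; rewrite -fsumEFin//.
rewrite -(esum_fset finF); last by move=> x _; rewrite lee_fin usum_ge0.
rewrite [RHS]esum_mkcond.
transitivity (\esum_(x in [set: T]) \esum_(y in [set: T]) (a x y)%:E).
  rewrite esum_esum; last by move=> x y _ _; rewrite lee_fin.
  by congr esum; apply/seteqP; split.
apply: eq_esum => x _; case: ifPn => [_|]; first exact: esum_EFin.
by rewrite notin_setE => Fx; rewrite esum1// => y _; rewrite aF.
Qed.

Lemma summable_rows T (a : T -> T -> R) (F : set T) : finite_set F ->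
  (forall x y, ~ F x -> a x y = 0) ->
  (forall x, absolutely_summable (a x)) ->
  absolutely_summable (fun p : T * T => a p.1 p.2).
Proof.
move=> finF aF sa; rewrite /absolutely_summable /summable.
rewrite (ge0_esum_rows (a := fun x y => `|a x y|) finF) ?ltry//.
- by move=> x y Fx; rewrite aF// normr0.
- by move=> x; apply: summable_le (sa x) => y; rewrite normr_id.
Qed.

(** Fubini's theorem, in the only case needed for finitely supported test
    functions: finitely many rows are nonzero. *)
Lemma usum_rows T (a : T -> T -> R) (F : set T) : finite_set F ->
  (forall x y, ~ F x -> a x y = 0) ->
  (forall x, absolutely_summable (a x)) ->
  usum (fun p : T * T => a p.1 p.2) = \sum_(x \in F) usum (a x).
Proof.
move=> finF aF sa.
have aFp x y : ~ F x -> (a x)^\+ y = 0.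
  by move=> Fx; rewrite /funrpos aF// maxxx.
have aFn x y : ~ F x -> (a x)^\- y = 0.
  by move=> Fx; rewrite /funrneg aF// oppr0 maxxx.
have sp x := summable_funrpos (sa x); have sn x := summable_funrneg (sa x).
have -> : \sum_(x \in F) usum (a x) =
    \sum_(x \in F) usum ((a x)^\+) - \sum_(x \in F) usum ((a x)^\-).
  apply/eqP; rewrite eq_sym subr_eq -fsbig_split//; apply/eqP.
  by apply: eq_fsbigr => x _; rewrite /= (usum_funrposneg (sa x)) subrK.
have p0 x := funrpos_ge0 (a x); have n0 x := funrneg_ge0 (a x).
rewrite (@usum_split _ _ (fun p : T * T => (a p.1)^\+ p.2)
                         (fun p : T * T => (a p.1)^\- p.2))//.
- congr (_ - _); apply: EFin_inj.
  + rewrite -(ge0_esum_rows finF p0 aFp sp) esum_EFin//.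
    exact: summable_rows finF aFp sp.
  + rewrite -(ge0_esum_rows finF n0 aFn sn) esum_EFin//.
    exact: summable_rows finF aFn sn.
- by move=> p; exact: funrpos_sub_neg.
- exact: summable_rows finF aFp sp.
- exact: summable_rows finF aFn sn.
Qed.

End UnorderedSums.

(** * Edge energies and the ground state transform *)

Section Graphs.
Context {R : realType} {X : discreteTopologicalType}.
Implicit Types (b a : X -> X -> R) (m V f w h : X -> R).

Lemma summable_graph b x : is_graph b -> absolutely_summable (b x).
Proof.
move=> gb; rewrite ge0_summableE//; first exact: graph_summable.
exact: graph_ge0.
Qed.

Lemma summable_formal_domain b f x : is_graph b -> formal_domain b f ->
  absolutely_summable (fun y => b x y * f y).
Proof.
move=> gb fb; suff: absolutely_summable (fun y => b x y * `|f y|).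
  by apply: summable_le => y; rewrite !normrM normr_id.
by rewrite ge0_summableE; [exact: fb|move=> y; rewrite mulr_ge0// graph_ge0].
Qed.

Lemma formal_domain_le b f g : is_graph b -> (forall x, `|f x| <= `|g x|) ->
  formal_domain b g -> formal_domain b f.
Proof.
move=> gb fg bg x; apply: le_lt_trans (bg x); apply: le_esum => y _.
by rewrite lee_fin ler_wpM2l// graph_ge0.
Qed.

Lemma formal_domainZ b f (c : R) : is_graph b -> formal_domain b f ->
  formal_domain b (fun x => c * f x).
Proof.
move=> gb bf x; rewrite -ge0_summableE; last first.
  by move=> y; rewrite mulr_ge0// graph_ge0.
suff: absolutely_summable (fun y => c * (b x y * f y)).
  by apply: summable_le => y; rewrite !normrM !normr_id mulrCA.
exact/absolutely_summableZ/summable_formal_domain.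
Qed.

Lemma summable_flux b f x : is_graph b -> formal_domain b f ->
  absolutely_summable (fun y => b x y * (f x - f y)).
Proof.
move=> gb bf.
apply: (eq_summable (a := fun y => f x * b x y - b x y * f y)).
  by move=> y; ring.
apply: absolutely_summableB; last exact: summable_formal_domain.
exact/absolutely_summableZ/summable_graph.
Qed.

Lemma mul_laplacian b m f x : strictly_positive m ->
  m x * laplacian b m f x = usum (fun y => b x y * (f x - f y)).
Proof. by move=> m0; rewrite /laplacian mulrA divff ?mul1r// gt_eqF. Qed.

(** The weights of the ground state transform form again a graph, so that edge
    energies of [b] and of its transforms are handled alike. *)
Lemma is_graph_transform b w : is_graph b -> (forall x, 0 <= w x) ->
  formal_domain b w -> is_graph (fun x y => b x y * w x * w y).
Proof.
move=> gb w0 bw; split.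
- by move=> x y; rewrite !mulr_ge0// graph_ge0.
- by move=> x y; rewrite (graph_sym gb); ring.
- by move=> x; rewrite graph_diag// !mul0r.
- move=> x; rewrite -ge0_summableE; last first.
    by move=> y; rewrite !mulr_ge0// graph_ge0.
  apply: (eq_summable (a := fun y => w x * (b x y * w y))).
    by move=> y; ring.
  exact/absolutely_summableZ/summable_formal_domain.
Qed.

Definition edge_energy a f : R :=
  usum (fun p : X * X => a p.1 p.2 * (f p.1 - f p.2) ^+ 2).

(** The bound (s - t)^2 <= 2 s^2 + 2 t^2 dominates the energy density by a function
    with finitely many nonzero rows plus its mirror image. *)
Lemma summable_edge_energy a f : is_graph a -> finitely_supported f ->
  absolutely_summable (fun p : X * X => a p.1 p.2 * (f p.1 - f p.2) ^+ 2).
Proof.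
move=> ga sf; pose A x y := 2 * f x ^+ 2 * a x y.
have sA : absolutely_summable (fun p : X * X => A p.1 p.2).
  apply: (summable_rows sf); last first.
    by move=> x; exact/absolutely_summableZ/summable_graph.
  by move=> x y /negP; rewrite negbK /A => /eqP->; rewrite expr0n mulr0 mul0r.
apply: summable_le (absolutely_summableD sA (summable_swap sA)) => -[x y] /=.
have a0 := graph_ge0 ga x y; rewrite /A (graph_sym ga y x).
rewrite !ger0_norm; last 2 first.
- by rewrite addr_ge0// mulr_ge0// mulr_ge0// sqr_ge0.
- by rewrite mulr_ge0// sqr_ge0.
rewrite -mulrDl mulrC ler_wpM2r//.
by have := sqr_ge0 (f x + f y); lra.
Qed.

Lemma edge_energy_ge0 a f : is_graph a -> 0 <= edge_energy a f.
Proof.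
by move=> ga; apply: usum_ge0 => p; rewrite mulr_ge0 ?sqr_ge0// graph_ge0.
Qed.

Lemma edge_le_energy a f x y : is_graph a -> finitely_supported f ->
  a x y * (f x - f y) ^+ 2 <= edge_energy a f.
Proof.
move=> ga sf; have s := summable_edge_energy ga sf.
apply: (@le_usum_term _ _ _ (x, y) _ s) => p.
by rewrite mulr_ge0 ?sqr_ge0// graph_ge0.
Qed.

Lemma le_edge_energy a a' (C : R) f : is_graph a -> is_graph a' ->
  (forall x y, a x y <= C * a' x y) -> finitely_supported f ->
  edge_energy a f <= C * edge_energy a' f.
Proof.
move=> ga ga' aa' sf; have s' := summable_edge_energy ga' sf.
rewrite -usumZ//; apply: le_usum; first exact: summable_edge_energy.
  exact: absolutely_summableZ.
by move=> p; rewrite mulrA ler_wpM2r ?sqr_ge0.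
Qed.

Lemma finitely_supportedM w f : finitely_supported f ->
  finitely_supported (fun x => w x * f x).
Proof.
apply: sub_finite_set => x /=; apply: contra_neq => ->; exact: mulr0.
Qed.

(** On each pair of vertices
<<
      (w(x) f(x) - w(y) f(y))^2
        = w(x) w(y) (f(x) - f(y))^2
          + w(x) f(x)^2 (w(x) - w(y)) + w(y) f(y)^2 (w(y) - w(x)).
>>
    Weighted with b, the last two terms are mirror images of each other, and
    summing one of them row by row gives the Laplacian of w. *)
Lemma ground_state_transform b m V w f :
  is_graph b -> strictly_positive m -> (forall x, 0 <= w x) ->
  formal_domain b w -> finitely_supported f ->
  energy_form b m V (fun x => w x * f x) =
    2^-1 * edge_energy (fun x y => b x y * w x * w y) f
    + \sum_(x \in [set: X]) m x * f x ^+ 2 * (w x * schroedinger b m V w x).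
Proof.
move=> gb m0 w0 bw sf; set F := [set x | f x != 0] in sf.
have fF x : ~ F x -> f x = 0 by move/negP; rewrite negbK => /eqP.
pose A x y := w x * f x ^+ 2 * (b x y * (w x - w y)).
have AF x y : ~ F x -> A x y = 0.
  by move=> /fF; rewrite /A => ->; rewrite expr0n mulr0 mul0r.
have sA x : absolutely_summable (A x).
  exact/absolutely_summableZ/summable_flux.
have sAA := summable_rows sf AF sA.
have sE := summable_edge_energy (is_graph_transform gb w0 bw) sf.
rewrite /energy_form -[fine _]ge0_usumE; last first.
  by move=> p; rewrite mulr_ge0 ?sqr_ge0// graph_ge0.
rewrite (eq_usum (b := fun p : X * X =>
  b p.1 p.2 * w p.1 * w p.2 * (f p.1 - f p.2) ^+ 2
  + (A p.1 p.2 + A p.2 p.1))); last first.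
  by move=> [x y] /=; rewrite /A (graph_sym gb y x); ring.
rewrite usumD//; last exact: absolutely_summableD (summable_swap sAA).
rewrite usumD//; last exact: summable_swap sAA.
rewrite (usum_swap (fun p : X * X => A p.1 p.2)) (usum_rows sf AF sA).
rewrite -/(edge_energy _ _) mulrDr -addrA; congr (_ + _).
rewrite -mulr2n -[X in 2^-1 * X]mulr_natl mulKf ?pnatr_eq0//.
rewrite -!(fsbig_widen F [set: X])//=; last 2 first.
- by move=> x [_ /fF fx0] /=; rewrite fx0 expr0n mulr0 mul0r.
- by move=> x [_ /fF fx0] /=; rewrite fx0 mulr0 expr0n mulr0.
rewrite -fsbig_split//; apply: eq_fsbigr => x _ /=.
rewrite usumZ; last exact: summable_flux.
by rewrite -(mul_laplacian _ _ _ m0) /schroedinger; ring.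
Qed.

End Graphs.

(** * Super- and subharmonic functions *)

Section Liouville.
Context {R : realType} {X : discreteTopologicalType}.
Implicit Types (b a : X -> X -> R) (m V f u w h v : X -> R).

Lemma connected_graph_ind b (P : X -> Prop) x y : connected_graph b ->
  (forall z z', 0 < b z z' -> P z -> P z') -> P x -> P y.
Proof.
move=> cb bP; have [s [+ <-]] := cb x y; elim: s x => //= z s IHs x.
by move=> /andP[/bP xz /IHs zs] /xz.
Qed.

Lemma le_schroedinger b m V f g x : is_graph b -> strictly_positive m ->
  formal_domain b f -> formal_domain b g ->
  f x = g x -> (forall y, f y <= g y) ->
  schroedinger b m V g x <= schroedinger b m V f x.
Proof.
move=> gb m0 bf bg fgx fg; rewrite /schroedinger fgx lerD2r.
rewrite -(ler_pM2l (m0 x)) !mul_laplacian//.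
apply: le_usum; [exact: summable_flux|exact: summable_flux|move=> y].
by rewrite ler_wpM2l ?graph_ge0// fgx lerD2l lerN2.
Qed.

Lemma schroedingerZ b m V f (c : R) x : is_graph b -> strictly_positive m ->
  formal_domain b f ->
  schroedinger b m V (fun y => c * f y) x = c * schroedinger b m V f x.
Proof.
move=> gb m0 bf; apply: (mulfI (lt0r_neq0 (m0 x))).
rewrite /schroedinger mulrDr mul_laplacian//.
rewrite (eq_usum (b := fun y => c * (b x y * (f x - f y)))); last first.
  by move=> y; ring.
rewrite usumZ; last exact: summable_flux.
by rewrite -(mul_laplacian _ _ _ m0); ring.
Qed.

(** A zero of h is a minimum, so superharmonicity there makes h vanish at all
    neighbours; connectedness spreads this to the whole graph. *)
Lemma superharmonic_gt0 b m V h : is_graph b -> connected_graph b ->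
  strictly_positive m -> positive_fun h -> superharmonic b m V h ->
  strictly_positive h.
Proof.
move=> gb cb m0 [h0 hN0] [bh sh] x; rewrite lt_neqAle h0 andbT eq_sym.
apply/eqP => hx0; apply: hN0; apply/funext => y /=.
suff step z z' : 0 < b z z' -> h z = 0 -> h z' = 0.
  exact: (connected_graph_ind (P := fun z => h z = 0) y cb step hx0).
move=> zz' hz0.
have := sh z; rewrite /schroedinger hz0 mulr0 addr0 -(pmulr_rge0 _ (m0 z)).
rewrite mul_laplacian// (eq_usum (b := fun y => - (b z y * h y))); last first.
  by move=> z''; rewrite hz0 sub0r mulrN.
have sz := summable_formal_domain z gb bh.
rewrite usumN// oppr_ge0 => le0.
have /le_trans/(_ le0) : b z z' * h z' <= usum (fun y => b z y * h y).
  apply: (le_usum_term (a := fun y => b z y * h y)) => // t.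
  by rewrite mulr_ge0// graph_ge0.
by rewrite pmulr_rle0// => le; apply/eqP; rewrite eq_le le h0.
Qed.

Lemma superharmonic_energy b m V h f : is_graph b -> strictly_positive m ->
  (forall x, 0 <= h x) -> superharmonic b m V h -> finitely_supported f ->
  2^-1 * edge_energy (fun x y => b x y * h x * h y) f
    <= energy_form b m V (fun x => h x * f x).
Proof.
move=> gb m0 h0 [bh sh] sf; rewrite ground_state_transform// lerDl.
apply: fsumr_ge0 => x _; have mx := ltW (m0 x).
by rewrite mulr_ge0// mulr_ge0 ?sqr_ge0.
Qed.

Lemma subharmonic_energy b m V w f : is_graph b -> strictly_positive m ->
  (forall x, 0 <= w x) -> formal_domain b w ->
  (forall x, w x * schroedinger b m V w x <= 0) -> finitely_supported f ->
  energy_form b m V (fun x => w x * f x)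
    <= 2^-1 * edge_energy (fun x y => b x y * w x * w y) f.
Proof.
move=> gb m0 w0 bw sw sf; rewrite ground_state_transform// gerDl.
rewrite -oppr_ge0 -mulN1r mulr_fsumr.
apply: fsumr_ge0 => x _; rewrite mulN1r oppr_ge0; have mx := ltW (m0 x).
by rewrite mulr_ge0_le0// mulr_ge0 ?sqr_ge0.
Qed.

(** Kato's inequality, multiplied by |u| so that zeros of u need no separate
    treatment: |u(x)| |u(y)| >= u(x) u(y). *)
Lemma abs_subharmonic b m V u x : is_graph b -> strictly_positive m ->
  harmonic b m V u ->
  `|u x| * schroedinger b m V (fun y => `|u y|) x <= 0.
Proof.
move=> gb m0 [bu hu].
have bau : formal_domain b (fun y => `|u y|).
  by apply: formal_domain_le bu => // y; rewrite normr_id.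
rewrite -(mulr0 (u x)) -(hu x) /schroedinger !mulrDr lerD//; last first.
  by rewrite mulrCA -normrM ger0_norm ?sqr_ge0// mulrCA.
rewrite -(ler_pM2l (m0 x)) mulrCA [leRHS]mulrCA !mul_laplacian//.
rewrite -!usumZ; [|exact: summable_flux|exact: summable_flux].
apply: le_usum => [||y].
- exact/absolutely_summableZ/summable_flux.
- exact/absolutely_summableZ/summable_flux.
rewrite mulrCA [leRHS]mulrCA ler_wpM2l ?graph_ge0// !mulrBr -!normrM.
by rewrite ger0_norm ?sqr_ge0// lerD2l lerN2 ler_norm.
Qed.

(** * Liouville comparison *)

(** Every vertex has capacity zero. *)
Definition recurrent a : Prop := forall x (e : R), 0 < e ->
  exists f, [/\ finitely_supported f, f x != 0 &
                edge_energy a f < e * f x ^+ 2].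

(** If the energies with weights b v v were at least e f(x)^2, the ground state
    transform would turn this bound into a Hardy weight concentrated at x; the
    weight d below is the one that makes the constants match. *)
Lemma critical_recurrent b m V v : is_graph b -> strictly_positive m ->
  strictly_positive v -> superharmonic b m V v -> ~ subcritical b m V ->
  recurrent (fun x y => b x y * v x * v y).
Proof.
move=> gb m0 v0 sv ncrit x e e0; apply: contrapT => noF; apply: ncrit.
have v_ge0 y := ltW (v0 y).
have [mN0 vN0] := (lt0r_neq0 (m0 x), lt0r_neq0 (v0 x)).
pose d := e / (2 * m x * v x ^+ 2).
have d0 : 0 < d by rewrite divr_gt0// !mulr_gt0// exprn_gt0.
exists (fun y => if y == x then d else 0); split.
  split=> [y|/(congr1 (@^~ x)) /=]; first by case: ifP => // _; exact: ltW.
  by rewrite eqxx => /eqP; rewrite gt_eqF.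
move=> phi sphi; pose f y := (v y)^-1 * phi y.
have -> : phi = fun y => v y * f y.
  by apply/funext => y; rewrite /f mulVKf// gt_eqF.
have sf : finitely_supported f by exact: finitely_supportedM.
apply: le_trans (superharmonic_energy gb m0 v_ge0 sv sf).
rewrite -(fsbig_widen [set x] [set: X])//=; last first.
  by move=> y [_ /= /eqP/negPf ->]; rewrite mulr0 mul0r.
rewrite fsbig_set1 eqxx.
have -> : m x * d * (v x * f x) ^+ 2 = 2^-1 * (e * f x ^+ 2).
  by rewrite /d; field; rewrite mN0 vN0.
rewrite ler_pM2l ?invr_gt0//; case: (eqVneq (f x) 0) => [->|fx0].
  rewrite expr0n mulr0; apply: edge_energy_ge0.
  by apply: is_graph_transform => //; case: sv.
by rewrite leNgt; apply/negP => lt; apply: noF; exists f.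
Qed.

(** The heart of the comparison: a test function f with small energy for [a] is
    nearly constant across the edge for the weights b w w, while (w/h) f is nearly
    constant across it for the weights b h h. *)
Lemma ratio_eq_on_edges b m V h w a (C : R) :
  is_graph b -> strictly_positive m ->
  strictly_positive h -> superharmonic b m V h ->
  (forall x, 0 <= w x) -> formal_domain b w ->
  (forall x, w x * schroedinger b m V w x <= 0) ->
  is_graph a -> recurrent a -> 0 < C ->
  (forall x y, b x y * w x * w y <= C * a x y) ->
  forall x y, 0 < b x y -> w x / h x = w y / h y.
Proof.
move=> gb m0 h0 sh w0 bw sw ga rec C0 bwa.
suff H x y : 0 < b x y -> 0 < w x -> w x / h x = w y / h y.
  move=> x y bxy; have [wx0|wx0] := ltP 0 (w x); first exact: H.
  have [wy0|wy0] := ltP 0 (w y).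
    by apply/esym/H => //; rewrite (graph_sym gb).
  have -> : w x = 0 by apply/eqP; rewrite eq_le wx0 w0.
  have -> : w y = 0 by apply/eqP; rewrite eq_le wy0 w0.
  by rewrite !mul0r.
move=> bxy wx0; have [hx hy] := (h0 x, h0 y).
set gx := w x / h x; set gy := w y / h y; apply: contrapT => gxy.
have gxy2 : 0 < (gx - gy) ^+ 2.
  by rewrite exprn_even_gt0//= subr_eq0; apply/eqP.
(* The two nearly-constant estimates will add up to (gx - gy)^2 <= K e, for
   every e > 0; e is then chosen so that K e is half of the left-hand side. *)
pose K1 := b x y * h x * h y; pose K2 := b x y * w x.
have K10 : 0 < K1 by rewrite !mulr_gt0.
have K20 : 0 < K2 by rewrite !mulr_gt0.
pose K := 2 * C * (K1^-1 + w y / h y ^+ 2 / K2).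
have K0 : 0 < K.
  rewrite !mulr_gt0// ltr_pwDl ?invr_gt0//.
  by rewrite !divr_ge0 ?sqr_ge0// ltW.
have [f [sf fx0 Ef]] := rec x _ (divr_gt0 gxy2 (mulr_gt0 (ltr0n R 2) K0)).
set e := (_ / _) in Ef.
have gw := is_graph_transform gb w0 bw.
have h_ge0 z := ltW (h0 z).
have gh := is_graph_transform gb h_ge0 sh.1.
have Ew : edge_energy (fun x y => b x y * w x * w y) f <= C * (e * f x ^+ 2).
  apply: le_trans (le_edge_energy gw ga bwa sf) _.
  by rewrite ler_pM2l// ltW.
pose psi z := (w z / h z) * f z.
have spsi : finitely_supported psi by exact: finitely_supportedM.
have Eh : edge_energy (fun x y => b x y * h x * h y) psi <= C * (e * f x ^+ 2).
  apply: le_trans Ew; rewrite -(ler_pM2l (x := 2^-1)) ?invr_gt0//.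
  apply: le_trans (superharmonic_energy gb m0 h_ge0 sh spsi) _.
  have -> : (fun z => h z * psi z) = (fun z => w z * f z).
    by apply/funext => z; rewrite /psi; field; rewrite gt_eqF.
  exact: subharmonic_energy.
have psi_le := le_trans (edge_le_energy x y gh spsi) Eh.
have f_le := le_trans (edge_le_energy x y gw sf) Ew.
have {}psi_le : (psi x - psi y) ^+ 2 <= K1^-1 * (C * (e * f x ^+ 2)).
  by rewrite mulrC ler_pdivlMr// mulrC.
have {}f_le : gy ^+ 2 * (f x - f y) ^+ 2 <=
    w y / h y ^+ 2 / K2 * (C * (e * f x ^+ 2)).
  have -> : gy ^+ 2 * (f x - f y) ^+ 2 =
      w y / h y ^+ 2 / K2 * (b x y * w x * w y * (f x - f y) ^+ 2).
    by rewrite /gy /K2; field; rewrite !gt_eqF.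
  by apply: ler_wpM2l f_le; rewrite !divr_ge0 ?sqr_ge0// ltW.
have : f x ^+ 2 * (gx - gy) ^+ 2 <= f x ^+ 2 * (K * e).
  have : f x ^+ 2 * (gx - gy) ^+ 2 <=
      2 * (psi x - psi y) ^+ 2 + 2 * (gy ^+ 2 * (f x - f y) ^+ 2).
    (* f(x) (gx - gy) = (psi(x) - psi(y)) - gy (f(x) - f(y)). *)
    have := sqr_ge0 ((psi x - psi y) + gy * (f x - f y)).
    rewrite /psi -/gx -/gy; nra.
  move/le_trans; apply.
  apply: (le_trans (lerD (ler_wpM2l (ler0n R 2) psi_le)
                         (ler_wpM2l (ler0n R 2) f_le))).
  by rewrite /K le_eqVlt; apply/orP; left; apply/eqP; ring.
rewrite ler_pM2l ?exprn_even_gt0//.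
have -> : K * e = (gx - gy) ^+ 2 / 2.
  by rewrite /e; field; rewrite gt_eqF.
lra.
Qed.

(** * Comparison with the Green function *)

(** The minimum of G and h / c competes in the minimality of G; the constant c is
    chosen so that the two functions agree at o, where the minimum therefore still
    satisfies the inequality of G itself. *)
Lemma green_le_superharmonic b m (o : X) (G h : X -> R) : is_graph b ->
  strictly_positive m -> is_green_function b m (cst 1) o G ->
  strictly_positive h -> superharmonic b m (cst 1) h ->
  exists2 c : R, 0 < c & forall x, c * G x <= h x.
Proof.
move=> gb m0 [[G0 bG sG] minG] h0 [bh sh].
pose c := h o / G o; have c0 : 0 < c by rewrite divr_gt0.
exists c => // x; rewrite -ler_pdivlMl//.
pose k y := c^-1 * h y; pose g y := Order.min (G y) (k y).
have k0 y : 0 < k y by rewrite mulr_gt0 ?invr_gt0.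
have g0 y : 0 < g y by rewrite lt_min G0 k0.
have bk : formal_domain b k by exact: formal_domainZ.
have gG y : g y <= G y by rewrite ge_min lexx.
have gk y : g y <= k y by rewrite ge_min lexx orbT.
have bg : formal_domain b g.
  by apply: formal_domain_le bG => // y; rewrite !gtr0_norm.
suff /minG/(_ x)/le_trans : green_supersolution b m (cst 1) o g by apply.
split=> // y; have [Gk|kG] := leP (G y) (k y).
  apply: le_trans (sG y) _; apply: le_schroedinger => //.
  by rewrite /g min_l.
have yo : y <> o.
  by move=> yo; move: kG; rewrite yo /k /c invf_div divfK ?ltxx// gt_eqF.
rewrite indicE memNset//.
apply: (@le_trans _ _ (schroedinger b m (cst 1) k y)).
  by rewrite schroedingerZ// mulr_ge0// ltW// invr_gt0.
by apply: le_schroedinger => //; rewrite /g min_r// ltW.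
Qed.

Lemma superharmonic_le_potential b m V V' h : (forall x, V x <= V' x) ->
  (forall x, 0 <= h x) -> superharmonic b m V h -> superharmonic b m V' h.
Proof.
move=> VV' h0 [bh sh]; split=> // x; apply: le_trans (sh x) _.
by rewrite /schroedinger lerD2l ler_wpM2r.
Qed.

Lemma liminf_at_infinity_ge f (c : R) : (forall x, c <= f x) ->
  (c%:E <= liminf_at_infinity f)%E.
Proof.
move=> cf; rewrite /liminf_at_infinity limf_einfE.
apply: (@le_trans _ _ (ereal_inf [set (f x)%:E | x in [set: X]])).
  by apply: le_ereal_inf_tmp => _ [x _ <-]; rewrite lee_fin.
apply: ereal_sup_ubound; exists [set: X] => //.
by rewrite /frechet_filter /= setCT.
Qed.

End Liouville.

(** * The Liouville theorem *)

Theorem theorem3p1 (R : realType) (X : discreteTopologicalType)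
    (X_countable : countable [set: X]) (X_infinite : infinite_set [set: X])
    (m : X -> R) (m_gt0 : strictly_positive m)
    (b : X -> X -> R) (b_graph : is_graph b) (b_connected : connected_graph b)
    (V : X -> R) (V_le1 : forall x, V x <= 1)
    (H_positive : positive_operator b m V)
    (b' : X -> X -> R) (b'_graph : is_graph b')
    (b'_connected : connected_graph b')
    (V' : X -> R) (H'_critical : critical b' m V')
    (v : X -> R) (v_ground_state : agmon_ground_state b' m V' v)
    (v_gt0 : strictly_positive v)
    (o : X) (G1 : X -> R) (G1_green : is_green_function b m (cst 1) o G1)
    (u : X -> R) (u_harmonic : harmonic b m V u)
    (u_bound : exists2 C : R, 0 < C &
      forall x y, b x y * `|u x| * `|u y| <= C * b' x y * v x * v y)
    (u_liminf : liminf_at_infinity (fun x => `|u x| / G1 x) = 0%:E) :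
  u = cst 0.
Proof.
have [h [h_pos h_super]] := H_positive.
have h0 := superharmonic_gt0 b_graph b_connected m_gt0 h_pos h_super.
have [C C0 buv] := u_bound.
have [_ [bv hv] _] := v_ground_state.
have v_super : superharmonic b' m V' v by split=> // x; rewrite hv.
have rec := critical_recurrent b'_graph m_gt0 v_gt0 v_super H'_critical.2.
have gv := is_graph_transform b'_graph (fun x => ltW (v_gt0 x)) bv.
have bu : formal_domain b (fun x => `|u x|).
  by apply: formal_domain_le u_harmonic.1 => // x; rewrite normr_id.
have ratio := ratio_eq_on_edges b_graph m_gt0 h0 h_super
  (fun x => normr_ge0 (u x)) bu
  (fun x => abs_subharmonic x b_graph m_gt0 u_harmonic) gv rec C0.
have {}ratio x y : 0 < b x y -> `|u x| / h x = `|u y| / h y.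
  by apply: ratio => z z'; rewrite !mulrA.
have h_super1 := superharmonic_le_potential V_le1 (fun x => ltW (h0 x)) h_super.
have [c c0 cG] := green_le_superharmonic b_graph m_gt0 G1_green h0 h_super1.
have G0 : strictly_positive G1 by case: G1_green => -[].
apply/funext => x /=; apply: contrapT => /eqP ux0.
pose d := `|u x| / h x.
have d0 : 0 < d by rewrite divr_gt0// normr_gt0.
have uE y : `|u y| = d * h y.
  suff -> : d = `|u y| / h y by rewrite divfK// gt_eqF.
  have step z z' : 0 < b z z' -> d = `|u z| / h z -> d = `|u z'| / h z'.
    by move=> /ratio <-.
  by apply: (@connected_graph_ind _ _ b (fun z => d = `|u z| / h z)
    x y b_connected step).
have /liminf_at_infinity_ge : forall y, d * c <= `|u y| / G1 y.
  by move=> y; rewrite ler_pdivlMr// uE -mulrA ler_pM2l.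
by rewrite u_liminf lee_fin leNgt mulr_gt0.
Qed.
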